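(* Let $\Omega\subset\mathbb{R}^4$ be open, let $\nu:\Omega\to\mathbb{C}(\mathbf{i}_1)$, and let $f_0:\Omega\to\mathbb{C}(\mathbf{i}_1)$ be a nonvanishing solution of the complexified Schrödinger equation $(\triangle_{\mathbb{C}}-\nu(z_1,z_2))f=0$ in $\Omega$. Let $W:\Omega\to\mathbb{T}$ be a twice continuously differentiable solution of the bicomplex Vekua equation $$\left(\partial_{\omega^{\dagger_2}}-\frac{\partial_{\omega^{\dagger_2}}f_0}{f_0}\,C\right)W=0 .$$ Then $u=\mathrm{Sc}(W)$ is a solution of $(\triangle_{\mathbb{C}}-\nu(z_1,z_2))u=0$, and $v=\mathrm{Vec}(W)$ is a solution of $$\left(\triangle_{\mathbb{C}}+\nu(z_1,z_2)-2\left(\frac{|\nabla_{\mathbb{C}}f_0|_{\mathbf{i}_1}}{f_0}\right)^{2}\right)v=0,$$ where $\nabla_{\mathbb{C}}=\partial_{z_1}+\mathbf{i}_2\,\partial_{z_2}$ and $\left(\frac{|\nabla_{\mathbb{C}}f_0|_{\mathbf{i}_1}}{f_0}\right)^{2}$ denotes $\frac{|\nabla_{\mathbb{C}}f_0|^2_{\mathbf{i}_1}}{f_0^2}$.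
   Context: The bicomplex numbers are the commutative real algebra $\mathbb{T}=\{w_0+w_1\mathbf{i}_1+w_2\mathbf{i}_2+w_3\mathbf{j} : w_0,\dots,w_3\in\mathbb{R}\}$ with $\mathbf{i}_1^2=\mathbf{i}_2^2=-1$, $\mathbf{j}^2=1$, $\mathbf{i}_1\mathbf{i}_2=\mathbf{i}_2\mathbf{i}_1=\mathbf{j}$. Put $\mathbb{C}(\mathbf{i}_1)=\{x+y\mathbf{i}_1: x,y\in\mathbb{R}\}$. Every $\omega\in\mathbb{T}$ is uniquely $\omega=z_1+z_2\mathbf{i}_2$ with $z_1,z_2\in\mathbb{C}(\mathbf{i}_1)$; then $\mathrm{Sc}(\omega)=z_1$, $\mathrm{Vec}(\omega)=z_2$, $\omega^{\dagger_2}=z_1-z_2\mathbf{i}_2$ and $|\omega|^2_{\mathbf{i}_1}=\omega\,\omega^{\dagger_2}=z_1^2+z_2^2\in\mathbb{C}(\mathbf{i}_1)$. The space $\mathbb{T}$ is identified with $\mathbb{R}^4$ through $z_1=x_1+y_1\mathbf{i}_1$, $z_2=x_2+y_2\mathbf{i}_1$. $C$ denotes the operator $CW=W^{\dagger_2}$ (applied pointwise to functions). For $\mathbb{T}$-valued functions on open subsets of $\mathbb{R}^4$: $\partial_{z_k}=\frac12(\partial_{x_k}-\mathbf{i}_1\partial_{y_k})$ for $k=1,2$; $\partial_{\omega^{\dagger_2}}=\frac12(\partial_{z_1}+\mathbf{i}_2\partial_{z_2})$; $\triangle_{\mathbb{C}}=\partial_{z_1}^2+\partial_{z_2}^2$.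 Functions are not assumed holomorphic in $z_1,z_2$. A solution of a second-order equation means a twice continuously differentiable function satisfying it pointwise. *)

(* Defs.v *)
From HB Require Import structures.
From mathcomp Require Import all_boot all_order all_algebra.
From mathcomp Require Import all_classical all_reals all_analysis.
From mathcomp Require Import complex ring.

Set Implicit Arguments.
Unset Strict Implicit.
Unset Printing Implicit Defensive.

Import Order.TTheory GRing.Theory Num.Theory.
Import numFieldNormedType.Exports.

Local Open Scope classical_set_scope.
Local Open Scope ring_scope.

(* Bicomplex w0 w1 w2 w3 stands for w0 + w1 i1 + w2 i2 + w3 j. *)
Record bicomplex (R : Type) : Type :=
  Bicomplex { bc0 : R; bc1 : R; bc2 : R; bc3 : R }.

Module BicomplexEqChoice.
Section BicomplexEqChoice.
Variable R : Type.

Definition to_prod (w : bicomplex R) := (bc0 w, bc1 w, bc2 w, bc3 w).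
Definition of_prod (p : R * R * R * R) :=
  let: (a, b, c, d) := p in Bicomplex a b c d.

Lemma to_prodK : cancel to_prod of_prod.
Proof. by case. Qed.

End BicomplexEqChoice.
End BicomplexEqChoice.

HB.instance Definition _ (R : choiceType) := Choice.copy (bicomplex R)
  (can_type (@BicomplexEqChoice.to_prodK R)).

Section BicomplexAlgebra.
Variable R : realType.
Implicit Types u v w : bicomplex R.

Definition bc_zero : bicomplex R := Bicomplex 0 0 0 0.
Definition bc_one : bicomplex R := Bicomplex 1 0 0 0.

Definition bc_opp w :=
  Bicomplex (- bc0 w) (- bc1 w) (- bc2 w) (- bc3 w).

Definition bc_add u v :=
  Bicomplex (bc0 u + bc0 v) (bc1 u + bc1 v) (bc2 u + bc2 v) (bc3 u + bc3 v).

(* The multiplication table is i1^2 = i2^2 = -1, j^2 = 1, i1 i2 = i2 i1 = j,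
   hence i1 j = j i1 = - i2 and i2 j = j i2 = - i1. *)
Definition bc_mul u v := Bicomplex
  (bc0 u * bc0 v - bc1 u * bc1 v - bc2 u * bc2 v + bc3 u * bc3 v)
  (bc0 u * bc1 v + bc1 u * bc0 v - bc2 u * bc3 v - bc3 u * bc2 v)
  (bc0 u * bc2 v + bc2 u * bc0 v - bc1 u * bc3 v - bc3 u * bc1 v)
  (bc0 u * bc3 v + bc3 u * bc0 v + bc1 u * bc2 v + bc2 u * bc1 v).

Definition bc_scale (a : R) w :=
  Bicomplex (a * bc0 w) (a * bc1 w) (a * bc2 w) (a * bc3 w).

Lemma bc_addA : associative bc_add.
Proof. by case=> ? ? ? ? [? ? ? ?] [? ? ? ?]; rewrite /bc_add /= !addrA. Qed.
Lemma bc_addC : commutative bc_add.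
Proof. by case=> ? ? ? ? [? ? ? ?]; congr Bicomplex; rewrite addrC. Qed.
Lemma bc_add0 : left_id bc_zero bc_add.
Proof. by case=> ? ? ? ?; rewrite /bc_add /= !add0r. Qed.
Lemma bc_addN : left_inverse bc_zero bc_opp bc_add.
Proof. by case=> ? ? ? ?; rewrite /bc_add /= !addNr. Qed.

HB.instance Definition _ := GRing.isZmodule.Build (bicomplex R)
  bc_addA bc_addC bc_add0 bc_addN.

Lemma bc_mulA : associative bc_mul.
Proof. by case=> ? ? ? ? [? ? ? ?] [? ? ? ?]; congr Bicomplex => /=; ring. Qed.
Lemma bc_mulC : commutative bc_mul.
Proof. by case=> ? ? ? ? [? ? ? ?]; congr Bicomplex => /=; ring. Qed.
Lemma bc_mul1 : left_id bc_one bc_mul.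
Proof. by case=> ? ? ? ?; congr Bicomplex => /=; ring. Qed.
Lemma bc_mulDl : left_distributive bc_mul +%R.
Proof. by case=> ? ? ? ? [? ? ? ?] [? ? ? ?]; congr Bicomplex => /=; ring. Qed.
Lemma bc_one_neq0 : bc_one != 0.
Proof. by apply/eqP => -[] /eqP; rewrite oner_eq0. Qed.

HB.instance Definition _ := GRing.Zmodule_isComNzRing.Build (bicomplex R)
  bc_mulA bc_mulC bc_mul1 bc_mulDl bc_one_neq0.

Lemma bc_scaleA a b w : bc_scale a (bc_scale b w) = bc_scale (a * b) w.
Proof. by case: w => *; congr Bicomplex => /=; ring. Qed.
Lemma bc_scale1 : left_id 1 bc_scale.
Proof. by case=> *; congr Bicomplex => /=; ring. Qed.
Lemma bc_scaleDr : right_distributive bc_scale +%R.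
Proof. by move=> a [? ? ? ?] [? ? ? ?]; congr Bicomplex => /=; ring. Qed.
Lemma bc_scaleDl w : {morph bc_scale^~ w : a b / a + b}.
Proof. by case: w => ? ? ? ? a b; congr Bicomplex => /=; ring. Qed.

HB.instance Definition _ := GRing.Zmodule_isLmodule.Build R (bicomplex R)
  bc_scaleA bc_scale1 bc_scaleDr bc_scaleDl.

Lemma bc_scaleAl (a : R) u v : a *: (u * v) = (a *: u) * v.
Proof. by case: u v => ? ? ? ? [? ? ? ?]; congr Bicomplex => /=; ring. Qed.

HB.instance Definition _ :=
  GRing.Lmodule_isLalgebra.Build R (bicomplex R) bc_scaleAl.

Lemma bc_scaleAr (a : R) u v : a *: (u * v) = u * (a *: v).
Proof. by case: u v => ? ? ? ? [? ? ? ?]; congr Bicomplex => /=; ring. Qed.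

HB.instance Definition _ :=
  GRing.Lalgebra_isAlgebra.Build R (bicomplex R) bc_scaleAr.

Definition bci1 : bicomplex R := Bicomplex 0 1 0 0.
Definition bci2 : bicomplex R := Bicomplex 0 0 1 0.
Definition bcj : bicomplex R := Bicomplex 0 0 0 1.

Lemma bicomplexE w :
  w = (bc0 w)%:A + bc1 w *: bci1 + bc2 w *: bci2 + bc3 w *: bcj.
Proof. by case: w => *; congr Bicomplex => /=; ring. Qed.

Lemma bci1_sqr : bci1 ^+ 2 = -1.
Proof. by congr Bicomplex => /=; ring. Qed.
Lemma bci2_sqr : bci2 ^+ 2 = -1.
Proof. by congr Bicomplex => /=; ring. Qed.
Lemma bcj_sqr : bcj ^+ 2 = 1.
Proof. by congr Bicomplex => /=; ring. Qed.
Lemma bci1i2 : bci1 * bci2 = bcj.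
Proof. by congr Bicomplex => /=; ring. Qed.

(* C(i1) is represented by the field R[i], with x +i* y read as x + y i1 and
   embedded in the bicomplex numbers by bc_of. *)
Definition bc_of (z : R[i]) : bicomplex R :=
  Bicomplex (complex.Re z) (complex.Im z) 0 0.

Lemma bc_of_is_zmod_morphism : zmod_morphism bc_of.
Proof. by case=> ? ? [? ?]; congr Bicomplex => /=; ring. Qed.
Lemma bc_of_is_monoid_morphism : monoid_morphism bc_of.
Proof. by split=> // -[? ?] [? ?]; congr Bicomplex => /=; ring. Qed.

HB.instance Definition _ := GRing.isZmodMorphism.Build R[i] (bicomplex R) bc_of
  bc_of_is_zmod_morphism.
HB.instance Definition _ := GRing.isMonoidMorphism.Build R[i] (bicomplex R)
  bc_of bc_of_is_monoid_morphism.

(* Since j = i1 i2, the decomposition w = z1 + z2 i2 has z1 = w0 + w1 i1 and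
   z2 = w2 + w3 i1. *)
Definition Sc w : R[i] := Complex (bc0 w) (bc1 w).
Definition Vec w : R[i] := Complex (bc2 w) (bc3 w).

Lemma Sc_Vec w : w = bc_of (Sc w) + bc_of (Vec w) * bci2.
Proof. by case: w => *; congr Bicomplex => /=; ring. Qed.

Lemma Sc_Vec_uniq z1 z2 w :
  w = bc_of z1 + bc_of z2 * bci2 -> z1 = Sc w /\ z2 = Vec w.
Proof.
by case: z1 z2 => [? ?] [? ?] ->; split; congr Complex => /=; ring.
Qed.

Definition dag2 w : bicomplex R := bc_of (Sc w) - bc_of (Vec w) * bci2.

Definition normi1sq w : bicomplex R := w * dag2 w.

Lemma normi1sqE w : normi1sq w = bc_of (Sc w ^+ 2 + Vec w ^+ 2).
Proof. by case: w => *; congr Bicomplex => /=; ring. Qed.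

End BicomplexAlgebra.

Arguments bci1 {R}.
Arguments bci2 {R}.
Arguments bcj {R}.

Section Operators.
Variable R : realType.
Implicit Types (Omega : set 'rV[R]_4) (W : 'rV[R]_4 -> bicomplex R).

(* Coordinates on R^4 are ordered (x1, y1, x2, y2). *)
Definition ix1 : 'I_4 := @Ordinal 4 0 isT.
Definition iy1 : 'I_4 := @Ordinal 4 1 isT.
Definition ix2 : 'I_4 := @Ordinal 4 2 isT.
Definition iy2 : 'I_4 := @Ordinal 4 3 isT.

Definition pder (i : 'I_4) (g : 'rV[R]_4 -> R) : 'rV[R]_4 -> R :=
  fun p => 'D_(delta_mx 0 i) g p.

(* All iterated partial derivatives of g up to order k exist and are
   continuous on Omega (meant for Omega open). *)
Fixpoint real_Ck (k : nat) Omega (g : 'rV[R]_4 -> R) : Prop :=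
  (forall p, Omega p -> {for p, continuous g}) /\
  (if k is k'.+1 then
     forall i : 'I_4,
       (forall p, Omega p -> derivable g p (delta_mx 0 i)) /\
       real_Ck k' Omega (pder i g)
   else True).

Definition bc_Ck (k : nat) Omega W : Prop :=
  [/\ real_Ck k Omega (fun p => bc0 (W p)),
      real_Ck k Omega (fun p => bc1 (W p)),
      real_Ck k Omega (fun p => bc2 (W p)) &
      real_Ck k Omega (fun p => bc3 (W p))].

Definition bc_pder (i : 'I_4) W : 'rV[R]_4 -> bicomplex R := fun p =>
  Bicomplex (pder i (fun q => bc0 (W q)) p) (pder i (fun q => bc1 (W q)) p)
            (pder i (fun q => bc2 (W q)) p) (pder i (fun q => bc3 (W q)) p).

Definition dz1 W : 'rV[R]_4 -> bicomplex R := fun p =>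
  2^-1 *: (bc_pder ix1 W p - bci1 * bc_pder iy1 W p).
Definition dz2 W : 'rV[R]_4 -> bicomplex R := fun p =>
  2^-1 *: (bc_pder ix2 W p - bci1 * bc_pder iy2 W p).

Definition d_dag2 W : 'rV[R]_4 -> bicomplex R := fun p =>
  2^-1 *: (dz1 W p + bci2 * dz2 W p).

Definition gradC W : 'rV[R]_4 -> bicomplex R := fun p =>
  dz1 W p + bci2 * dz2 W p.

Definition laplC W : 'rV[R]_4 -> bicomplex R := fun p =>
  dz1 (dz1 W) p + dz2 (dz2 W) p.

(* A C(i1)-valued function, seen as a bicomplex-valued one. *)
Definition bc_fun (f : 'rV[R]_4 -> R[i]) : 'rV[R]_4 -> bicomplex R :=
  fun p => bc_of (f p).

Definition schrodinger (nu : 'rV[R]_4 -> R[i]) W : 'rV[R]_4 -> bicomplex R :=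
  fun p => laplC W p - bc_of (nu p) * W p.

(* Divisions by f0 take place in the field C(i1). *)
Definition vekua (f0 : 'rV[R]_4 -> R[i]) W : 'rV[R]_4 -> bicomplex R :=
  fun p =>
    d_dag2 W p - (d_dag2 (bc_fun f0) p * bc_of ((f0 p)^-1)) * dag2 (W p).

Definition dual_schrodinger (nu f0 : 'rV[R]_4 -> R[i]) W :
    'rV[R]_4 -> bicomplex R :=
  fun p => laplC W p + bc_of (nu p) * W p
    - 2 * (normi1sq (gradC (bc_fun f0) p) * bc_of ((f0 p ^+ 2)^-1)) * W p.

(* A solution in Omega of the second-order equation L f = 0 is required to be
   twice continuously differentiable. *)
Definition solution2 Omega
    (L : ('rV[R]_4 -> bicomplex R) -> 'rV[R]_4 -> bicomplex R)
    (f : 'rV[R]_4 -> R[i]) : Prop :=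
  bc_Ck 2 Omega (bc_fun f) /\ forall p, Omega p -> L (bc_fun f) p = 0.

End Operators.

(* Main.v *)
Require Import Defs.
From mathcomp Require Import all_boot all_order all_algebra.
From mathcomp Require Import all_classical all_reals all_analysis.
From mathcomp Require Import complex ring.

Set Implicit Arguments.
Unset Strict Implicit.
Unset Printing Implicit Defensive.

Import Order.TTheory GRing.Theory Num.Theory.
Import numFieldNormedType.Exports.

Local Open Scope classical_set_scope.
Local Open Scope ring_scope.

(** Write W = u + v i2, f = f0, and let a subscript k stand for the complex
    operator d/dz_k.  Since i2 squares to -1, the Vekua equation splits into a
    Cauchy-Riemann-like system for the C(i1)-valued functions u and v
    ([vekua_system]):
      f u_1 - f_1 u = (f v)_2      and      f u_2 - f_2 u = - (f v)_1.
    Let (E) be the first equation and (B) the second.  Applying d/dz_1 to (E)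
    and d/dz_2 to (B) and adding, the right-hand sides cancel because mixed
    derivatives of f v commute, and what is left is f Lap u = u Lap f, that is,
    f Lap u = nu f u.  Applying d/dz_2 to (E) and d/dz_1 to (B) and
    subtracting, the mixed derivatives of u cancel, which expresses
    f Lap v + v Lap f through first derivatives of u and v; multiplying by f
    and using (E) and (B) once more removes these first derivatives and leaves
    f (f Lap v + v Lap f) = 2 (f_1^2 + f_2^2) v.  Dividing by powers of f, which
    is invertible, gives both equations.

    Two analytic ingredients support this computation.  The operators d/dz_k
    are derivations of the algebra of bicomplex-valued functions ([dzD],
    [dzM]), and they commute on twice continuously differentiable functions
    ([dz_comm]).  The second fact comes down to the symmetry of mixed
    directional derivatives of a real function ([schwarz]), which is deduced
    from the mean value theorem. *)

(** * Symmetry of mixed directional derivatives *)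

Lemma is_derive_line (R : realType) (V : normedModType R) (g : V -> R)
    (p a : V) (t : R) :
  derivable g (p + t *: a) a ->
  is_derive t 1 (fun s => g (p + s *: a)) ('D_a g (p + t *: a)).
Proof.
have quotE : (fun h : R =>
    h^-1 *: (((fun s => g (p + s *: a)) \o shift t) (h *: 1) - g (p + t *: a)))
  = (fun h => h^-1 *: ((g \o shift (p + t *: a)) (h *: a) - g (p + t *: a))).
  apply/funext => h /=; congr (_ *: (g _ - _)).
  by rewrite /shift /= [h *: 1]mulr1 scalerDl addrCA.
by move=> dg; split; rewrite /derivable /derive quotE.
Qed.

Lemma MVT_line (R : realType) (V : normedModType R) (g : V -> R)
    (p a : V) (h : R) :
  0 <= h ->
  (forall t, t \in `[0, h] -> derivable g (p + t *: a) a) ->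
  exists2 t, t \in `[0, h] & g (p + h *: a) - g p = h * 'D_a g (p + t *: a).
Proof.
move=> h0 dg.
have [|||t th] := @MVT_segment R (fun s => g (p + s *: a))
  (fun s => 'D_a g (p + s *: a)) 0 h => //.
- move=> t th; apply: is_derive_line; apply: dg.
  exact: subset_itv_oo_cc th.
- apply: derivable_within_continuous => t th.
  by have [] := is_derive_line (dg t th).
- by rewrite scale0r addr0 subr0 mulrC => e; exists t.
Qed.

(** The left-hand side is symmetric in a and b, the right-hand side evaluates
    only one of the two mixed derivatives: comparing the two versions of this
    lemma is what makes the mixed derivatives agree. *)
Lemma second_difference_mvt (R : realType) (V : normedModType R) (g : V -> R)
    (p a b : V) (h : R) :
  0 <= h ->
  (forall s t, s \in `[0, h] -> t \in `[0, h] ->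
     derivable g (p + s *: a + t *: b) a /\
     derivable ('D_a g) (p + s *: a + t *: b) b) ->
  exists s t, [/\ s \in `[0, h], t \in `[0, h] &
    g (p + h *: a + h *: b) - g (p + h *: a) - (g (p + h *: b) - g p) =
    h ^+ 2 * 'D_b ('D_a g) (p + s *: a + t *: b)].
Proof.
move=> h0 dg.
have hI : h \in `[0, h] by rewrite in_itv /= lexx h0.
have zI : 0 \in `[0, h] by rewrite in_itv /= lexx h0.
(* The second difference is the increment of G between p and p + h a. *)
pose G x := g (x + h *: b) - g x.
have dG s : s \in `[0, h] ->
    is_derive (p + s *: a) a G
      ('D_a g (p + s *: a + h *: b) - 'D_a g (p + s *: a)).
  move=> sI; apply: is_deriveB.
    have [dga _] := dg _ _ sI hI.
    have quotE : (fun k : R => k^-1 *: (((fun x => g (x + h *: b)) \o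
        shift (p + s *: a)) (k *: a) - g (p + s *: a + h *: b)))
      = (fun k => k^-1 *: ((g \o shift (p + s *: a + h *: b)) (k *: a)
          - g (p + s *: a + h *: b))).
      by apply/funext => k /=; rewrite /shift /= !addrA.
    by split; rewrite /derivable /derive quotE.
  have [+ _] := dg _ _ sI zI; rewrite scale0r addr0 => dga.
  exact: derivableP.
have [|s sI eG] := @MVT_line R V G p a h h0.
  by move=> s /dG [].
have [|t tI et] := @MVT_line R V ('D_a g) (p + s *: a) b h h0.
  by move=> t tI; have [] := dg _ _ sI tI.
exists s, t; split=> //.
move: eG; rewrite (@derive_val _ _ _ _ _ _ _ (dG _ sI)) et.
by rewrite expr2 -mulrA => <-.
Qed.

(** By [second_difference_mvt], both mixed derivatives take a common value at
    points of arbitrarily small parallelograms at p, and continuity at p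
    carries the equality over to p. *)
Theorem schwarz (R : realType) (V : normedModType R) (g : V -> R) (p a b : V) :
  (\forall q \near p, derivable g q a /\ derivable ('D_a g) q b) ->
  (\forall q \near p, derivable g q b /\ derivable ('D_b g) q a) ->
  {for p, continuous ('D_b ('D_a g))} ->
  {for p, continuous ('D_a ('D_b g))} ->
  'D_b ('D_a g) p = 'D_a ('D_b g) p.
Proof.
move=> dab dba cab cba.
apply/eqP; rewrite -subr_eq0 -normr_le0; apply/ler_addgt0Pr => e e0.
rewrite add0r.
have e2 : 0 < e / 2 by rewrite divr_gt0.
have : \forall q \near p,
    [/\ derivable g q a /\ derivable ('D_a g) q b,
        derivable g q b /\ derivable ('D_b g) q a,
        `|'D_b ('D_a g) p - 'D_b ('D_a g) q| < e / 2 &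
        `|'D_a ('D_b g) p - 'D_a ('D_b g) q| < e / 2].
  move/cvgrPdist_lt/(_ _ e2) : cab => cab.
  move/cvgrPdist_lt/(_ _ e2) : cba => cba.
  apply: filterS (filterI (filterI dab dba) (filterI cab cba)).
  by move=> q [[dabq dbaq] [abq baq]]; exact: And4 dabq dbaq abq baq.
move=> /nbhs_normP[r /= r0 near_p].
(* With this h the parallelogram on h a and h b lies in the ball of radius r
   at p; the summand 1 keeps M positive when a = b = 0. *)
pose M := 1 + `|a| + `|b|.
have M0 : 0 < M by rewrite /M -addrA ltr_pwDl// addr_ge0.
pose h := r / (2 * M).
have h0 : 0 < h by rewrite divr_gt0// mulr_gt0.
have box s t : s \in `[0, h] -> t \in `[0, h] ->
    ball_ Num.norm p r (p + s *: a + t *: b).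
  rewrite !in_itv /= => /andP[s0 sh] /andP[t0 th].
  rewrite /ball_ /= -addrA opprD addNKr normrN.
  apply: le_lt_trans (ler_normD _ _) _; rewrite !normrZ !ger0_norm//.
  apply: (@le_lt_trans _ _ (h * M)).
    rewrite /M !mulrDr mulr1 -addrA ler_wpDl ?(ltW h0)//.
    by rewrite lerD// ler_wpM2r.
  rewrite /h invfM mulrA mulfVK ?gt_eqF//.
  by rewrite ltr_pdivrMr// ltr_pMr// ltr1n.
have [||s [t [sI tI est]]] := @second_difference_mvt R V g p a b h.
- exact: ltW.
- by move=> s t sI tI; have [] := near_p _ (box _ _ sI tI).
have [||t' [s' [tI' sI' est']]] := @second_difference_mvt R V g p b a h.
- exact: ltW.
- move=> t' s' tI' sI'; rewrite addrAC.
  by have [] := near_p _ (box _ _ sI' tI').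
have [_ _ ab_q _] := near_p _ (box _ _ sI tI).
have [_ _ _ ba_q] := near_p _ (box _ _ sI' tI').
have exchange (A B C D X Y : R) :
    A - B - (C - D) = X -> A - C - (B - D) = Y -> X = Y.
  by move=> <- <-; ring.
have close (X Y z : R) : `|X - z| < e / 2 -> `|Y - z| < e / 2 -> `|X - Y| <= e.
  move=> Xz Yz; rewrite [leRHS]splitr (le_trans (ler_distD z _ _))//.
  by rewrite lerD ?ltW// distrC.
rewrite [p + t' *: b + _]addrAC [p + h *: b + _]addrAC in est'.
have h2 : h ^+ 2 != 0 by rewrite expf_neq0// gt_eqF.
by rewrite -(mulfI h2 (exchange _ _ _ _ _ _ est est')) in ba_q;
  exact: close ab_q ba_q.
Qed.

(** * Partial derivatives of bicomplex-valued functions *)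

Lemma real_Ck_cst (R : realType) (k : nat) (Omega : set 'rV[R]_4) (c : R) :
  real_Ck k Omega (fun=> c).
Proof.
elim: k c => [|k IHk] c; first by split=> // p _; exact: cst_continuous.
split=> [p _|i]; first exact: cst_continuous.
split=> [p _|]; first exact: derivable_cst.
suff -> : pder i (fun=> c) = fun=> 0 by [].
by apply/funext => p; exact: derive_cst.
Qed.

Lemma pder_comm (R : realType) (Omega : set 'rV[R]_4) (g : 'rV[R]_4 -> R)
    (i j : 'I_4) (p : 'rV[R]_4) :
  open Omega -> real_Ck 2 Omega g -> Omega p ->
  pder i (pder j g) p = pder j (pder i g) p.
Proof.
move=> oO [_ Cg] Op; have OO := open_nbhs_nbhs (conj oO Op).
apply: schwarz.
- apply: filterS OO => q Oq.
  by have [/(_ q Oq) dg [_ /(_ i)[/(_ q Oq) dgi _]]] := Cg j.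
- apply: filterS OO => q Oq.
  by have [/(_ q Oq) dg [_ /(_ j)[/(_ q Oq) dgj _]]] := Cg i.
- by have [_ [_ /(_ i)[_ [/(_ p Op)]]]] := Cg j.
- by have [_ [_ /(_ j)[_ [/(_ p Op)]]]] := Cg i.
Qed.

(** Existence of all first partial derivatives at a point: the least
    requirement under which sum and product rules hold at that point. *)
Definition bc_derivable (R : realType) (U : 'rV[R]_4 -> bicomplex R)
    (p : 'rV[R]_4) : Prop :=
  forall i, [/\ derivable (fun q => bc0 (U q)) p (delta_mx 0 i),
                derivable (fun q => bc1 (U q)) p (delta_mx 0 i),
                derivable (fun q => bc2 (U q)) p (delta_mx 0 i) &
                derivable (fun q => bc3 (U q)) p (delta_mx 0 i)].

Lemma bc_derivable_cst (R : realType) (c : bicomplex R) (p : 'rV[R]_4) :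
  bc_derivable (fun=> c) p.
Proof. by move=> i; split; exact: derivable_cst. Qed.

Lemma bc_derivableD (R : realType) (U V : 'rV[R]_4 -> bicomplex R) p :
  bc_derivable U p -> bc_derivable V p -> bc_derivable (fun q => U q + V q) p.
Proof.
by move=> dU dV i; have [? ? ? ?] := dU i; have [? ? ? ?] := dV i;
  split; exact: derivableD.
Qed.

Lemma bc_derivableM (R : realType) (U V : 'rV[R]_4 -> bicomplex R) p :
  bc_derivable U p -> bc_derivable V p -> bc_derivable (fun q => U q * V q) p.
Proof.
move=> dU dV i; have [u0 u1 u2 u3] := dU i; have [v0 v1 v2 v3] := dV i.
split.
- exact: (derivableD (derivableB (derivableB (derivableM u0 v0)
    (derivableM u1 v1)) (derivableM u2 v2)) (derivableM u3 v3)).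
- exact: (derivableB (derivableB (derivableD (derivableM u0 v1)
    (derivableM u1 v0)) (derivableM u2 v3)) (derivableM u3 v2)).
- exact: (derivableB (derivableB (derivableD (derivableM u0 v2)
    (derivableM u2 v0)) (derivableM u1 v3)) (derivableM u3 v1)).
- exact: (derivableD (derivableD (derivableD (derivableM u0 v3)
    (derivableM u3 v0)) (derivableM u1 v2)) (derivableM u2 v1)).
Qed.

Lemma bc_pder_cst (R : realType) (i : 'I_4) (c : bicomplex R) (p : 'rV[R]_4) :
  bc_pder i (fun=> c) p = 0.
Proof. by congr Bicomplex; exact: derive_cst. Qed.

Lemma bc_is_pder (R : realType) (i : 'I_4) (U : 'rV[R]_4 -> bicomplex R) p :
  bc_derivable U p ->
  [/\ is_derive p (delta_mx 0 i) (fun q => bc0 (U q)) (bc0 (bc_pder i U p)),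
      is_derive p (delta_mx 0 i) (fun q => bc1 (U q)) (bc1 (bc_pder i U p)),
      is_derive p (delta_mx 0 i) (fun q => bc2 (U q)) (bc2 (bc_pder i U p)) &
      is_derive p (delta_mx 0 i) (fun q => bc3 (U q)) (bc3 (bc_pder i U p))].
Proof. by move=> /(_ i)[d0 d1 d2 d3]; split; exact: derivableP. Qed.

Lemma bc_pderD (R : realType) (i : 'I_4) (U V : 'rV[R]_4 -> bicomplex R) p :
  bc_derivable U p -> bc_derivable V p ->
  bc_pder i (fun q => U q + V q) p = bc_pder i U p + bc_pder i V p.
Proof.
by move=> /(_ i)[? ? ? ?] /(_ i)[? ? ? ?]; congr Bicomplex; exact: deriveD.
Qed.

(** Every component of a bicomplex product is a signed sum of four products of
    components, so the rule reduces to the real one; abstracting the values of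
    the partial derivatives first turns the rest into polynomial identities. *)
Lemma bc_pderM (R : realType) (i : 'I_4) (U V : 'rV[R]_4 -> bicomplex R) p :
  bc_derivable U p -> bc_derivable V p ->
  bc_pder i (fun q => U q * V q) p = bc_pder i U p * V p + U p * bc_pder i V p.
Proof.
move=> dU dV.
have [u0 u1 u2 u3] := bc_is_pder i dU; have [v0 v1 v2 v3] := bc_is_pder i dV.
move: {dU dV} (bc_pder i U p) (bc_pder i V p) u0 u1 u2 u3 v0 v1 v2 v3.
move=> U' V' u0 u1 u2 u3 v0 v1 v2 v3; congr Bicomplex; rewrite /pder /=.
- have /(@derive_val _ _ _ _ _ _ _) -> := is_deriveD (is_deriveB (is_deriveB
    (is_deriveM u0 v0) (is_deriveM u1 v1)) (is_deriveM u2 v2))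
    (is_deriveM u3 v3).
  by rewrite /GRing.scale /=; ring.
- have /(@derive_val _ _ _ _ _ _ _) -> := is_deriveB (is_deriveB (is_deriveD
    (is_deriveM u0 v1) (is_deriveM u1 v0)) (is_deriveM u2 v3))
    (is_deriveM u3 v2).
  by rewrite /GRing.scale /=; ring.
- have /(@derive_val _ _ _ _ _ _ _) -> := is_deriveB (is_deriveB (is_deriveD
    (is_deriveM u0 v2) (is_deriveM u2 v0)) (is_deriveM u1 v3))
    (is_deriveM u3 v1).
  by rewrite /GRing.scale /=; ring.
- have /(@derive_val _ _ _ _ _ _ _) -> := is_deriveD (is_deriveD (is_deriveD
    (is_deriveM u0 v3) (is_deriveM u3 v0)) (is_deriveM u1 v2))
    (is_deriveM u2 v1).
  by rewrite /GRing.scale /=; ring.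
Qed.

Lemma bc_pderZ (R : realType) (i : 'I_4) (c : bicomplex R)
    (U : 'rV[R]_4 -> bicomplex R) p :
  bc_derivable U p -> bc_pder i (fun q => c * U q) p = c * bc_pder i U p.
Proof.
move=> dU; rewrite (bc_pderM _ (bc_derivable_cst c p) dU).
by rewrite bc_pder_cst mul0r add0r.
Qed.

Lemma bc_pder_near (R : realType) (i : 'I_4) (U V : 'rV[R]_4 -> bicomplex R) p :
  (\forall q \near p, U q = V q) -> bc_pder i U p = bc_pder i V p.
Proof.
move=> UV; congr Bicomplex; apply: near_eq_derive;
  by apply: filterS UV => q ->.
Qed.

(** * The operators d/dz_1 and d/dz_2 *)

(** Both complex operators have this form, with (a, b) the indices of the real
    and imaginary parts of the variable, so their calculus is developed once
    for all pairs. *)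
Definition dz (R : realType) (a b : 'I_4) (U : 'rV[R]_4 -> bicomplex R) :
    'rV[R]_4 -> bicomplex R :=
  fun p => 2^-1 *: (bc_pder a U p - bci1 * bc_pder b U p).

(** As multiplications by constants of the algebra, rather than by real scalars,
    the coefficients are covered by the product rule. *)
Lemma dzE (R : realType) (a b : 'I_4) (U : 'rV[R]_4 -> bicomplex R) p :
  dz a b U p = 2^-1%:A * bc_pder a U p + (2^-1%:A * - bci1) * bc_pder b U p.
Proof. by rewrite -mulrA -mulrDr mulr_algl mulNr. Qed.

Lemma dz_fun (R : realType) (a b : 'I_4) (U : 'rV[R]_4 -> bicomplex R) :
  dz a b U = fun p =>
    2^-1%:A * bc_pder a U p + (2^-1%:A * - bci1) * bc_pder b U p.
Proof. by apply/funext => p; exact: dzE. Qed.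

Lemma dz_near (R : realType) (a b : 'I_4) (U V : 'rV[R]_4 -> bicomplex R) p :
  (\forall q \near p, U q = V q) -> dz a b U p = dz a b V p.
Proof. by move=> UV; rewrite !dzE !(bc_pder_near _ UV). Qed.

Lemma dz_cst (R : realType) (a b : 'I_4) (c : bicomplex R) p :
  dz a b (fun=> c) p = 0.
Proof. by rewrite dzE !bc_pder_cst !mulr0 addr0. Qed.

Lemma dzD (R : realType) (a b : 'I_4) (U V : 'rV[R]_4 -> bicomplex R) p :
  bc_derivable U p -> bc_derivable V p ->
  dz a b (fun q => U q + V q) p = dz a b U p + dz a b V p.
Proof.
by move=> dU dV; rewrite !dzE !bc_pderD// !mulrDr addrACA.
Qed.

Lemma dzM (R : realType) (a b : 'I_4) (U V : 'rV[R]_4 -> bicomplex R) p :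
  bc_derivable U p -> bc_derivable V p ->
  dz a b (fun q => U q * V q) p = dz a b U p * V p + U p * dz a b V p.
Proof.
move=> dU dV; rewrite !dzE !bc_pderM//; ring.
Qed.

Lemma dzZ (R : realType) (a b : 'I_4) (c : bicomplex R)
    (U : 'rV[R]_4 -> bicomplex R) p :
  bc_derivable U p -> dz a b (fun q => c * U q) p = c * dz a b U p.
Proof.
move=> dU; rewrite dzM ?dz_cst ?mul0r ?add0r//; exact: bc_derivable_cst.
Qed.

Lemma bc_C2_dable (R : realType) Omega (U : 'rV[R]_4 -> bicomplex R) p :
  bc_Ck 2 Omega U -> Omega p -> bc_derivable U p.
Proof.
move=> [[_ C0] [_ C1] [_ C2] [_ C3]] Op i.
by split; [have [/(_ p Op)] := C0 i|have [/(_ p Op)] := C1 i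
  |have [/(_ p Op)] := C2 i|have [/(_ p Op)] := C3 i].
Qed.

Lemma bc_C2_pder_dable (R : realType) Omega (U : 'rV[R]_4 -> bicomplex R) i p :
  bc_Ck 2 Omega U -> Omega p -> bc_derivable (bc_pder i U) p.
Proof.
move=> [[_ C0] [_ C1] [_ C2] [_ C3]] Op j.
split; [have [_ [_ /(_ j)[/(_ p Op)]]] := C0 i
  |have [_ [_ /(_ j)[/(_ p Op)]]] := C1 i
  |have [_ [_ /(_ j)[/(_ p Op)]]] := C2 i
  |have [_ [_ /(_ j)[/(_ p Op)]]] := C3 i] => //.
Qed.

Lemma bc_ext (R : Type) (u v : bicomplex R) :
  bc0 u = bc0 v -> bc1 u = bc1 v -> bc2 u = bc2 v -> bc3 u = bc3 v -> u = v.
Proof. by case: u v => ? ? ? ? [? ? ? ?] /= -> -> -> ->. Qed.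

Lemma bc_pder_comm (R : realType) Omega (U : 'rV[R]_4 -> bicomplex R) i j p :
  open Omega -> bc_Ck 2 Omega U -> Omega p ->
  bc_pder i (bc_pder j U) p = bc_pder j (bc_pder i U) p.
Proof.
move=> oO [C0 C1 C2 C3] Op; apply: bc_ext.
- exact: pder_comm oO C0 Op.
- exact: pder_comm oO C1 Op.
- exact: pder_comm oO C2 Op.
- exact: pder_comm oO C3 Op.
Qed.

Lemma dz_dable (R : realType) (a b : 'I_4) Omega
    (U : 'rV[R]_4 -> bicomplex R) p :
  bc_Ck 2 Omega U -> Omega p -> bc_derivable (dz a b U) p.
Proof.
move=> CU Op.
rewrite dz_fun.
have dU j := bc_C2_pder_dable j CU Op.
have dc c := @bc_derivable_cst R c p.
exact: bc_derivableD (bc_derivableM (dc _) (dU a))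
  (bc_derivableM (dc _) (dU b)).
Qed.

Lemma bc_pder_dz (R : realType) (a b i : 'I_4) Omega
    (U : 'rV[R]_4 -> bicomplex R) p :
  open Omega -> bc_Ck 2 Omega U -> Omega p ->
  bc_pder i (dz a b U) p = dz a b (bc_pder i U) p.
Proof.
move=> oO CU Op.
have dU j := bc_C2_pder_dable j CU Op.
have dc c := @bc_derivable_cst R c p.
rewrite dz_fun.
rewrite (bc_pderD _ (bc_derivableM (dc _) (dU a))
  (bc_derivableM (dc _) (dU b))).
have pderZ c j : bc_pder i (fun q => c * bc_pder j U q) p =
    c * bc_pder j (bc_pder i U) p.
  by rewrite (bc_pderZ i c (dU j)) (bc_pder_comm i j oO CU Op).
by rewrite (pderZ _ a) (pderZ _ b) dzE.
Qed.

(** Each operator is a combination, with constant coefficients, of partial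
    derivatives that commute with one another. *)
Lemma dz_comm (R : realType) (a b c d : 'I_4) Omega
    (U : 'rV[R]_4 -> bicomplex R) p :
  open Omega -> bc_Ck 2 Omega U -> Omega p ->
  dz a b (dz c d U) p = dz c d (dz a b U) p.
Proof.
move=> oO CU Op; have dU j := bc_C2_pder_dable j CU Op.
have dc k := @bc_derivable_cst R k p.
rewrite [LHS]dzE !(bc_pder_dz _ _ _ oO CU Op).
rewrite -(dzZ c d _ (dU a)) -(dzZ c d _ (dU b)).
rewrite -(dzD c d (bc_derivableM (dc _) (dU a)) (bc_derivableM (dc _) (dU b))).
by rewrite (dz_fun a b U).
Qed.

(** * Splitting the Vekua equation *)

Lemma dz1E (R : realType) (U : 'rV[R]_4 -> bicomplex R) :
  dz1 U = dz ix1 iy1 U.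
Proof. by []. Qed.

Lemma dz2E (R : realType) (U : 'rV[R]_4 -> bicomplex R) :
  dz2 U = dz ix2 iy2 U.
Proof. by []. Qed.

Lemma bc_Ck_bc_fun (R : realType) (k : nat) (Omega : set 'rV[R]_4)
    (f : 'rV[R]_4 -> R[i]) :
  real_Ck k Omega (fun p => complex.Re (f p)) ->
  real_Ck k Omega (fun p => complex.Im (f p)) -> bc_Ck k Omega (bc_fun f).
Proof. by move=> Cre Cim; split=> //; exact: real_Ck_cst. Qed.

(** The i2 and j components of [bc_fun f] vanish identically, hence so do their
    derivatives; and d/dz multiplies by elements of C(i1) only.  This is what
    allows one to read off scalar and vector parts of equations containing
    derivatives of C(i1)-valued functions. *)
Lemma dz_bc_fun (R : realType) (a b : 'I_4) (f : 'rV[R]_4 -> R[i]) p :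
  exists z, dz a b (bc_fun f) p = bc_of z.
Proof.
exists (Sc (dz a b (bc_fun f) p)); rewrite [LHS]Sc_Vec.
suff -> : Vec (dz a b (bc_fun f) p) = 0 by rewrite rmorph0 mul0r addr0.
have pder0 i : pder i (fun=> 0 : R) p = 0 by exact: derive_cst.
by apply/eqP; rewrite eq_complex /= !pder0; apply/andP; split; apply/eqP; ring.
Qed.

Lemma vekua_lhs_split (T : comNzRingType) (i a b c d : T) : i ^+ 2 = -1 ->
  a + b * i + i * (c + d * i) = a - d + (b + c) * i.
Proof.
move=> i2; have -> : a + b * i + i * (c + d * i) =
  a + d * i ^+ 2 + (b + c) * i by ring.
by rewrite i2 mulrN1.
Qed.

Lemma vekua_rhs_split (T : comNzRingType) (i f1 f2 u v : T) : i ^+ 2 = -1 ->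
  (f1 + i * f2) * (u - v * i) = f1 * u + f2 * v + (f2 * u - f1 * v) * i.
Proof.
move=> i2; have -> : (f1 + i * f2) * (u - v * i) =
  f1 * u - f2 * v * i ^+ 2 + (f2 * u - f1 * v) * i by ring.
by rewrite i2 mulrN1 opprK.
Qed.

Lemma bc_of_split (R : realType) (a b c d : R[i]) :
  bc_of a + bc_of b * bci2 = bc_of c + bc_of d * bci2 ->
  a = c /\ b = d.
Proof.
by move=> /Sc_Vec_uniq[-> ->]; have [<- <-] := @Sc_Vec_uniq _ a b _ erefl.
Qed.

(** The scalar and vector parts of 2 f times the Vekua equation.  All negative
    terms are moved to the other side, so that only sums and products have to
    be differentiated later on. *)
Lemma vekua_system (R : realType) (f0 : 'rV[R]_4 -> R[i])
    (W : 'rV[R]_4 -> bicomplex R) (p : 'rV[R]_4) :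
  let F := bc_fun f0 in
  let U := bc_fun (fun q => Sc (W q)) in
  let V := bc_fun (fun q => Vec (W q)) in
  bc_derivable U p -> bc_derivable V p -> f0 p != 0 -> vekua f0 W p = 0 ->
  F p * dz1 U p = F p * dz2 V p + (dz1 F p * U p + dz2 F p * V p) /\
  F p * dz2 U p + (F p * dz1 V p + dz1 F p * V p) = dz2 F p * U p.
Proof.
move=> F U V dU dV f_neq0 vek.
have W_UV : W = fun q => U q + V q * bci2.
  by apply/funext => q; exact: Sc_Vec.
have dc : bc_derivable (fun=> bci2) p by exact: bc_derivable_cst.
have dzW a b : dz a b W p = dz a b U p + dz a b V p * bci2.
  rewrite {1}W_UV (dzD _ _ dU (bc_derivableM dV dc)) (dzM _ _ dV dc).
  by rewrite dz_cst mulr0 addr0.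
have {vek} vek : F p * (dz1 W p + bci2 * dz2 W p) =
    (dz1 F p + bci2 * dz2 F p) * (U p - V p * bci2).
  (* The factor 1/2 in the definition of [d_dag2] occurs on both sides. *)
  have -> : dz1 W p + bci2 * dz2 W p = (dz1 F p + bci2 * dz2 F p) *
      bc_of (f0 p)^-1 * (U p - V p * bci2).
    have half_neq0 : (2^-1 : R) != 0 by rewrite invr_eq0 pnatr_eq0.
    apply: (scalerI half_neq0).
    by move/eqP: vek; rewrite subr_eq0 -!scalerAl => /eqP.
  rewrite -mulrA [LHS]mulrCA [F p * _]mulrA -rmorphM mulfV//.
  by rewrite rmorph1 mul1r.
move: vek; rewrite !dz1E !dz2E !dzW.
have [u1 ->] := dz_bc_fun ix1 iy1 (fun q => Sc (W q)) p.
have [u2 ->] := dz_bc_fun ix2 iy2 (fun q => Sc (W q)) p.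
have [v1 ->] := dz_bc_fun ix1 iy1 (fun q => Vec (W q)) p.
have [v2 ->] := dz_bc_fun ix2 iy2 (fun q => Vec (W q)) p.
have [f1 ->] := dz_bc_fun ix1 iy1 f0 p.
have [f2 ->] := dz_bc_fun ix2 iy2 f0 p.
rewrite /F /U /V /bc_fun; set u := Sc _; set v := Vec _; set f := f0 p.
rewrite vekua_lhs_split ?bci2_sqr// vekua_rhs_split ?bci2_sqr//.
rewrite mulrDr mulrA -!(rmorphM, rmorphD, rmorphB).
move=> /bc_of_split[e1 e2].
by split; congr bc_of; [rewrite -e1|rewrite -[RHS](subrK (f1 * v)) -e2]; ring.
Qed.

(** * Elimination of the conjugate function *)

(** Subscripts denote derivatives.  The last two hypotheses are the derivatives
    of the first equation of [vekua_system] along z_1 and of the second along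
    z_2.  When they are added, every term in v or its derivatives cancels. *)
Lemma schrodinger_elim (T : comNzRingType)
    (f f1 f2 f11 f12 f21 f22 u u1 u2 u11 u22 v v1 v2 v12 v21 : T) :
  f21 = f12 -> v21 = v12 ->
  f1 * u1 + f * u11 =
    f1 * v2 + f * v12 + (f11 * u + f1 * u1 + (f12 * v + f2 * v1)) ->
  f2 * u2 + f * u22 + (f2 * v1 + f * v21 + (f21 * v + f1 * v2)) =
    f22 * u + f2 * u2 ->
  f * (u11 + u22) = (f11 + f22) * u.
Proof.
move=> -> -> /eqP; rewrite -subr_eq0 => /eqP E1.
move=> /eqP; rewrite -subr_eq0 => /eqP B2.
apply/eqP; rewrite -subr_eq0; apply/eqP.
by rewrite -[RHS](addr0 0) -{1}E1 -B2; ring.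
Qed.

(** After the symmetry of the mixed derivatives, the hypotheses are the two
    equations (E) and (B) of [vekua_system], then the derivatives E_2 of (E)
    along z_2 and B_1 of (B) along z_1.  The conclusion is the combination
    f (B_1 - E_2) + 2 f_2 E - 2 f_1 B: the difference removes the second
    derivatives of u, and the multiples of (E) and (B) its first ones. *)
Lemma dual_schrodinger_elim (T : comNzRingType)
    (f f1 f2 f11 f12 f21 f22 u u1 u2 u12 u21 v v1 v2 v11 v22 : T) :
  f21 = f12 -> u21 = u12 ->
  f * u1 = f * v2 + (f1 * u + f2 * v) ->
  f * u2 + (f * v1 + f1 * v) = f2 * u ->
  f2 * u1 + f * u21 =
    f2 * v2 + f * v22 + (f21 * u + f1 * u2 + (f22 * v + f2 * v2)) ->
  f1 * u2 + f * u12 + (f1 * v1 + f * v11 + (f11 * v + f1 * v1)) =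
    f12 * u + f2 * u1 ->
  f * (f * (v11 + v22) + (f11 + f22) * v) = 2 * (f1 ^+ 2 + f2 ^+ 2) * v.
Proof.
move=> -> -> /eqP; rewrite -subr_eq0 => /eqP E.
move=> /eqP; rewrite -subr_eq0 => /eqP B.
move=> /eqP; rewrite -subr_eq0 => /eqP E2 /eqP; rewrite -subr_eq0 => /eqP B1.
apply/eqP; rewrite -subr_eq0; apply/eqP.
have -> : 0 = f * (0 - 0) + 2 * f2 * 0 - 2 * f1 * 0 :> T by ring.
by rewrite -{1}B1 -{1}E2 -{1}E -B; ring.
Qed.

Lemma divide_schrodinger (T : comNzRingType) (g f n u lu : T) :
  g * f = 1 -> f * lu = n * f * u -> lu - n * u = 0.
Proof.
move=> gf eqU; rewrite -[lu]mul1r -gf -[g * f * lu]mulrA eqU.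
have -> : g * (n * f * u) = (g * f) * (n * u) by ring.
by rewrite gf mul1r subrr.
Qed.

Lemma divide_dual_schrodinger (T : comNzRingType) (g f n N v lv : T) :
  g * f = 1 -> f * (f * lv + n * f * v) = 2 * N * v ->
  lv + n * v - 2 * (N * g ^+ 2) * v = 0.
Proof.
move=> gf eqV; have -> : lv + n * v = g ^+ 2 * (f * (f * lv + n * f * v)).
  have -> : g ^+ 2 * (f * (f * lv + n * f * v)) = (g * f) ^+ 2 * (lv + n * v).
    by ring.
  by rewrite gf expr1n mul1r.
by rewrite eqV; ring.
Qed.

(** * Differentiating the system, and conclusion *)

Lemma dz_vekua_eq1 (R : realType) (a b : 'I_4)
    (F F1 F2 U U1 V V2 : 'rV[R]_4 -> bicomplex R) (p : 'rV[R]_4) :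
  bc_derivable F p -> bc_derivable F1 p -> bc_derivable F2 p ->
  bc_derivable U p -> bc_derivable U1 p -> bc_derivable V p ->
  bc_derivable V2 p ->
  (\forall q \near p, F q * U1 q = F q * V2 q + (F1 q * U q + F2 q * V q)) ->
  dz a b F p * U1 p + F p * dz a b U1 p =
    dz a b F p * V2 p + F p * dz a b V2 p +
    (dz a b F1 p * U p + F1 p * dz a b U p +
     (dz a b F2 p * V p + F2 p * dz a b V p)).
Proof.
move=> dF dF1 dF2 dU dU1 dV dV2 /(@dz_near _ a b) eqD.
rewrite -(dzM a b dF dU1) -(dzM a b dF dV2) -(dzM a b dF1 dU).
rewrite -(dzM a b dF2 dV).
rewrite -(dzD a b (bc_derivableM dF1 dU) (bc_derivableM dF2 dV)).
rewrite -(dzD a b (bc_derivableM dF dV2)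
  (bc_derivableD (bc_derivableM dF1 dU) (bc_derivableM dF2 dV))).
exact: eqD.
Qed.

Lemma dz_vekua_eq2 (R : realType) (a b : 'I_4)
    (F F1 F2 U U2 V V1 : 'rV[R]_4 -> bicomplex R) (p : 'rV[R]_4) :
  bc_derivable F p -> bc_derivable F1 p -> bc_derivable F2 p ->
  bc_derivable U p -> bc_derivable U2 p -> bc_derivable V p ->
  bc_derivable V1 p ->
  (\forall q \near p, F q * U2 q + (F q * V1 q + F1 q * V q) = F2 q * U q) ->
  dz a b F p * U2 p + F p * dz a b U2 p +
    (dz a b F p * V1 p + F p * dz a b V1 p +
     (dz a b F1 p * V p + F1 p * dz a b V p)) =
  dz a b F2 p * U p + F2 p * dz a b U p.
Proof.
move=> dF dF1 dF2 dU dU2 dV dV1 /(@dz_near _ a b) eqD.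
rewrite -(dzM a b dF dU2) -(dzM a b dF dV1) -(dzM a b dF1 dV).
rewrite -(dzM a b dF2 dU).
rewrite -(dzD a b (bc_derivableM dF dV1) (bc_derivableM dF1 dV)).
rewrite -(dzD a b (bc_derivableM dF dU2)
  (bc_derivableD (bc_derivableM dF dV1) (bc_derivableM dF1 dV))).
exact: eqD.
Qed.

Lemma normi1sq_gradC (R : realType) (f : 'rV[R]_4 -> R[i]) p :
  normi1sq (gradC (bc_fun f) p) = dz1 (bc_fun f) p ^+ 2 + dz2 (bc_fun f) p ^+ 2.
Proof.
rewrite /gradC dz1E dz2E.
have [f1 ->] := dz_bc_fun ix1 iy1 f p.
have [f2 ->] := dz_bc_fun ix2 iy2 f p.
rewrite normi1sqE -!rmorphXn -rmorphD mulrC.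
by have [<- <-] := Sc_Vec_uniq (erefl (bc_of f1 + bc_of f2 * bci2)).
Qed.

Theorem theorem15 (R : realType) (Omega : set 'rV[R]_4)
    (nu f0 : 'rV[R]_4 -> R[i]) (W : 'rV[R]_4 -> bicomplex R)
    (hOmega : open Omega)
    (hf0_neq0 : forall p, Omega p -> f0 p != 0)
    (hf0 : solution2 Omega (schrodinger nu) f0)
    (hW2 : bc_Ck 2 Omega W)
    (hW : forall p, Omega p -> vekua f0 W p = 0) :
  solution2 Omega (schrodinger nu) (fun p => Sc (W p)) /\
  solution2 Omega (dual_schrodinger nu f0) (fun p => Vec (W p)).
Proof.
have [CF schrF] := hf0; have [CW0 CW1 CW2 CW3] := hW2.
pose F := bc_fun f0.
pose U := bc_fun (fun p => Sc (W p)); pose V := bc_fun (fun p => Vec (W p)).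
have CU : bc_Ck 2 Omega U by apply: bc_Ck_bc_fun; [exact: CW0|exact: CW1].
have CV : bc_Ck 2 Omega V by apply: bc_Ck_bc_fun; [exact: CW2|exact: CW3].
have sys q (Oq : Omega q) := vekua_system (bc_C2_dable CU Oq)
  (bc_C2_dable CV Oq) (hf0_neq0 q Oq) (hW q Oq).
have step p : Omega p ->
    F p * laplC U p = laplC F p * U p /\
    F p * (F p * laplC V p + laplC F p * V p) =
      2 * (dz1 F p ^+ 2 + dz2 F p ^+ 2) * V p.
  move=> Op; have Onear := open_nbhs_nbhs (conj hOmega Op).
  have near1 : \forall q \near p, F q * dz1 U q =
      F q * dz2 V q + (dz1 F q * U q + dz2 F q * V q).
    by apply: filterS Onear => q Oq; exact: proj1 (sys q Oq).
  have near2 : \forall q \near p, F q * dz2 U q +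
      (F q * dz1 V q + dz1 F q * V q) = dz2 F q * U q.
    by apply: filterS Onear => q Oq; exact: proj2 (sys q Oq).
  have [E B] := sys p Op.
  have dF := bc_C2_dable CF Op; have dDF a b := dz_dable a b CF Op.
  have dU := bc_C2_dable CU Op; have dDU a b := dz_dable a b CU Op.
  have dV := bc_C2_dable CV Op; have dDV a b := dz_dable a b CV Op.
  have E' a b := dz_vekua_eq1 a b dF (dDF ix1 iy1) (dDF ix2 iy2) dU
    (dDU ix1 iy1) dV (dDV ix2 iy2) near1.
  have B' a b := dz_vekua_eq2 a b dF (dDF ix1 iy1) (dDF ix2 iy2) dU
    (dDU ix2 iy2) dV (dDV ix1 iy1) near2.
  have E1 := E' ix1 iy1; have E2 := E' ix2 iy2.
  have B1 := B' ix1 iy1; have B2 := B' ix2 iy2.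
  have commF := dz_comm ix2 iy2 ix1 iy1 hOmega CF Op.
  have commU := dz_comm ix2 iy2 ix1 iy1 hOmega CU Op.
  have commV := dz_comm ix2 iy2 ix1 iy1 hOmega CV Op.
  split; first exact: schrodinger_elim commF commV E1 B2.
  exact: dual_schrodinger_elim commF commU E B E2 B1.
have laplF p : Omega p -> laplC F p = bc_of (nu p) * F p.
  by move=> /schrF /eqP; rewrite subr_eq0 => /eqP.
have invF p : Omega p -> bc_of (f0 p)^-1 * F p = 1.
  by move=> Op; rewrite -rmorphM mulVf ?rmorph1 ?hf0_neq0.
split; split; [exact: CU| |exact: CV|].
  move=> p Op; have [eqU _] := step p Op; rewrite (laplF p Op) in eqU.
  exact: divide_schrodinger (invF p Op) eqU.
move=> p Op; have [_ eqV] := step p Op; rewrite (laplF p Op) in eqV.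
rewrite /dual_schrodinger normi1sq_gradC -exprVn rmorphXn.
exact: divide_dual_schrodinger (invF p Op) eqV.
Qed.
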